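(* Let $d\ge3$. The surface $X_{A_d^{(2)}}\subset\mathbb{P}^d$ is not a general linear projection of its normalization $X_{\overline{A_d^{(2)}}}\subset\mathbb{P}^N$.
   Context: $\mathbb{P}^n$ is complex projective $n$-space. For an integer matrix $C$ with columns $(1,\mathbf{c}_0),\dots,(1,\mathbf{c}_n)$, $\mathbf{c}_j\in\mathbb{Z}^r$, the projective toric variety $X_C\subset\mathbb{P}^n$ is the Zariski closure of the image of the map $(\mathbb{C}^* )^r\to\mathbb{P}^n$, $\mathbf{t}\mapsto(\mathbf{t}^{\mathbf{c}_0}:\cdots:\mathbf{t}^{\mathbf{c}_n})$, where $\mathbf{t}^{\mathbf{c}}=\prod_i t_i^{c_i}$. $A_d^{(2)}$ is the $3\times(d+1)$ matrix with columns $(1,j,\binom{j}{2})$, $j=0,\dots,d$. Let $P(d)\subset\mathbb{R}^2$ be the convex hull of the points $(j,\binom{j}{2})$, $j=0,\dots,d$. $\overline{A_d^{(2)}}$ is the matrix whose columns are the vectors $(1,\mathbf{b})$ with $\mathbf{b}$ running over all lattice points of $P(d)\cap\mathbb{Z}^2$, and $X_{\overline{A_d^{(2)}}}\subset\mathbb{P}^N$, where $N+1$ is the number of these lattice points. $X_{\overline{A_d^{(2)}}}$ is the normalization of $X_{A_d^{(2)}}$, and $X_{A_d^{(2)}}$ is its image under the linear projection from $\mathbb{P}^N$ to $\mathbb{P}^d$ that keeps only the coordinates indexed by the columns of $A_d^{(2)}$. Meaning of the conclusion: there is a nonempty Zariski open subset of the space of surjective linear maps $\mathbb{C}^{N+1}\to\mathbb{C}^{d+1}$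 such that, for every linear map in this open set, the closure of the image of $X_{\overline{A_d^{(2)}}}$ under the induced linear projection from $\mathbb{P}^N$ to $\mathbb{P}^d$ is not projectively equivalent to $X_{A_d^{(2)}}$. *)

(* Defs.v *)
From HB Require Import structures.
From mathcomp Require Import all_boot all_order all_algebra.
From mathcomp Require Import complex mpoly.
From mathcomp Require Import classical_sets reals.

Set Implicit Arguments.
Unset Strict Implicit.
Unset Printing Implicit Defensive.

Import Order.TTheory GRing.Theory Num.Theory.

Local Open Scope classical_set_scope.
Local Open Scope ring_scope.

(* Points of P^n are given by their homogeneous coordinates, i.e. by nonzero
   row vectors of size n.+1, and a subset of P^n by the set of all the
   homogeneous coordinates of its points.  Linear maps K^m -> K^n are matrices
   L : 'M_(m, n) acting on row vectors by x |-> x *m L. *)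
Section Projective.
Variable K : fieldType.

(* The points of P^n having a homogeneous coordinate vector in S; the zero
   vector, which defines no point, is ignored if it belongs to S. *)
Definition proj_points n (S : set 'rV[K]_n.+1) : set 'rV[K]_n.+1 :=
  [set y | y != 0 /\ exists2 x, S x & exists a : K, y = a *: x].

Definition proj_closed n (Z : set 'rV[K]_n.+1) : Prop :=
  exists F : set {mpoly K[n.+1]},
    (forall p, F p -> exists k, p \is k.-homog) /\
    Z = [set x : 'rV[K]_n.+1 | x != 0 /\ forall p, F p -> p.@[x 0] = 0].

Definition proj_closure n (S : set 'rV[K]_n.+1) : set 'rV[K]_n.+1 :=
  smallest (@proj_closed n) S.

Definition proj_equiv n (X Y : set 'rV[K]_n.+1) : Prop :=
  exists2 M : 'M[K]_n.+1, M \in unitmx & Y = [set x *m M | x in X].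

(* The image of X under the rational map P^m --> P^n induced by L, which is
   undefined at the points x such that x *m L = 0. *)
Definition proj_image m n (L : 'M[K]_(m.+1, n.+1)) (X : set 'rV[K]_m.+1) :
    set 'rV[K]_n.+1 :=
  proj_points [set x *m L | x in X].

Definition aff_closed m n (Z : set 'M[K]_(m, n)) : Prop :=
  exists F : set {mpoly K[m * n]},
    Z = [set L : 'M[K]_(m, n) | forall p, F p -> p.@[mxvec L 0] = 0].

Definition surjections m n : set 'M[K]_(m, n) := [set L | row_full L].

Definition open_in_surjections m n (U : set 'M[K]_(m, n)) : Prop :=
  exists2 Z : set 'M[K]_(m, n), aff_closed Z & U = @surjections m n `\` Z.

End Projective.

(* The matrix with columns (1, c_j), where the c_j are the columns of c. *)
Definition add_ones r n (c : 'M[int]_(r, n)) : 'M[int]_(1 + r, n) :=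
  col_mx (const_mx 1) c.

Definition torus (K : fieldType) r : set 'rV[K]_r :=
  [set t | forall i, t 0 i != 0].

(* The exponents are the columns of C without their first entry, which is 1
   and only reflects the homogeneity of the parametrization. *)
Definition toric_map (K : fieldType) r n (C : 'M[int]_(1 + r, n.+1))
    (t : 'rV[K]_r) : 'rV[K]_n.+1 :=
  \row_j \prod_(i < r) t 0 i ^ (dsubmx C i j).

Definition toric_variety (K : fieldType) r n (C : 'M[int]_(1 + r, n.+1)) :
    set 'rV[K]_n.+1 :=
  proj_closure (proj_points [set toric_map C t | t in @torus K r]).

Definition binom_points (d : nat) : 'M[int]_(2, d.+1) :=
  \matrix_(i < 2, j < d.+1) (if i == 0 then j%:Z else 'C(j, 2)%:Z).

Definition binom_matrix (d : nat) : 'M[int]_(1 + 2, d.+1) :=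
  add_ones (binom_points d).

Definition conv_hull (R : realType) r n (c : 'M[R]_(r, n)) : set 'cV[R]_r :=
  [set x | exists w : 'cV[R]_n,
    [/\ forall j, 0 <= w j 0, \sum_j w j 0 = 1 & x = c *m w]].

Definition binom_polygon (R : realType) (d : nat) : set 'cV[R]_2 :=
  conv_hull (map_mx intr (binom_points d)).

Definition binom_lattice_points (R : realType) (d : nat) : set 'cV[int]_2 :=
  [set b | @binom_polygon R d (map_mx intr b)].

(* The columns of b are the lattice points of the polygon, in some order and
   without repetition. *)
Definition enum_lattice_points (R : realType) (d N : nat)
    (b : 'M[int]_(2, N.+1)) : Prop :=
  injective (fun k => col k b) /\
  range (fun k => col k b) = binom_lattice_points R d.

(* Main.v *)
(* Let b run over the lattice points of the polygon and let f = (f_0, ..., f_d) be the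
   parametrization t |-> (t^b)_b followed by the linear map L and by a change of coordinates of P^d.
   If the closure of its image is X_{A_d^(2)}, then f satisfies the binomial equations
   f_j f_{j+2}^3 = f_{j+1}^3 f_{j+3}, i.e. the third difference of j |-> log f_j vanishes.  In each
   case this forces a polynomial equation on L which is not an identity.

   For d >= 4, logarithmic derivatives of f_j are quadratic in j, so the first order jets of f span
   f_j * {1, j, j^2} and the second order ones lie in f_j * {1, ..., j^4}.  Hence, after any
   projection to P^4, the surface satisfies a Laplace equation whose symbol is a perfect square:
   the discriminant of the coefficients, which are 5 x 5 minors of the jet matrix, vanishes.  The
   translates of L by the torus allow one to evaluate the jets at t = (1, 1).

   For d = 3 the normalization is the scroll S(1, 3), so f_j = p_j(u) + x q_j(u) with p_j cubic and
   q_j linear.  By unique factorization the binomial equation forces the pencil of cubics cut out by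
   q = 0 to be spanned by two cubes, hence its Wronskian to be a square. *)

Require Import Defs.
From HB Require Import structures.
From mathcomp Require Import all_boot all_order all_algebra.
From mathcomp Require Import complex mpoly.
From mathcomp Require Import classical_sets reals.
From mathcomp Require Import ring zify.

Set Implicit Arguments.
Unset Strict Implicit.
Unset Printing Implicit Defensive.

Import Order.TTheory GRing.Theory Num.Theory.

Local Open Scope classical_set_scope.
Local Open Scope ring_scope.

(** * Polynomial functions on spaces of matrices *)

Section PolynomialFunctions.
Variable K : fieldType.

Definition polyfun m n (g : 'M[K]_(m, n) -> K) : Prop :=
  exists p : {mpoly K[m * n]}, forall L, p.@[mxvec L 0] = g L.

Section Closure.
Variables m n : nat.
Implicit Types g h : 'M[K]_(m, n) -> K.

Lemma polyfun_cst a : polyfun (fun _ : 'M[K]_(m, n) => a).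
Proof. by exists a%:MP => L; rewrite mevalC. Qed.

Lemma polyfun_entry i j : polyfun (fun L : 'M[K]_(m, n) => L i j).
Proof. by exists 'X_(mxvec_index i j) => L; rewrite mevalXU mxvecE. Qed.

Lemma polyfunB g h : polyfun g -> polyfun h -> polyfun (fun L => g L - h L).
Proof. by case=> p gE [q hE]; exists (p - q) => L; rewrite mevalB gE hE. Qed.

Lemma polyfunM g h : polyfun g -> polyfun h -> polyfun (fun L => g L * h L).
Proof. by case=> p gE [q hE]; exists (p * q) => L; rewrite mevalM gE hE. Qed.

Lemma polyfunX g k : polyfun g -> polyfun (fun L => g L ^+ k).
Proof. by case=> p gE; exists (p ^+ k) => L; rewrite rmorphXn /= gE. Qed.

Lemma polyfun_sum (I : Type) (r : seq I) (P : pred I) (g : I -> 'M[K]_(m, n) -> K) :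
  (forall i, polyfun (g i)) -> polyfun (fun L => \sum_(i <- r | P i) g i L).
Proof.
move=> hg; elim: r => [|i r [q hq]].
  by exists 0 => L; rewrite big_nil meval0.
have [p hp] := hg i.
exists ((if P i then p else 0) + q) => L; rewrite mevalD hq big_cons.
by case: (P i); rewrite ?hp // meval0 add0r.
Qed.

Lemma polyfun_prod (I : Type) (r : seq I) (P : pred I) (g : I -> 'M[K]_(m, n) -> K) :
  (forall i, polyfun (g i)) -> polyfun (fun L => \prod_(i <- r | P i) g i L).
Proof.
move=> hg; elim: r => [|i r [q hq]].
  by exists 1 => L; rewrite big_nil meval1.
have [p hp] := hg i.
exists ((if P i then p else 1) * q) => L; rewrite mevalM hq big_cons.
by case: (P i); rewrite ?hp // meval1 mul1r.
Qed.

Lemma polyfun_det k (A : 'M[K]_(m, n) -> 'M[K]_k) :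
  (forall i j, polyfun (fun L => A L i j)) -> polyfun (fun L => \det (A L)).
Proof.
move=> hA; apply: polyfun_sum => s; apply: polyfunM; first exact: polyfun_cst.
exact: polyfun_prod.
Qed.

Lemma polyfun_mulmxl k l (A : 'M[K]_(k, l)) (B : 'M[K]_(m, n) -> 'M[K]_(l, n)) i j :
  (forall i j, polyfun (fun L => B L i j)) -> polyfun (fun L => (A *m B L) i j).
Proof.
move=> hB.
have [p hp] : polyfun (fun L => \sum_j0 A i j0 * B L j0 j).
  by apply: polyfun_sum => k0; apply: polyfunM => //; exact: polyfun_cst.
by exists p => L; rewrite hp mxE.
Qed.

Lemma polyfun_ext g h : g =1 h -> polyfun g -> polyfun h.
Proof. by move=> gh [p hp]; exists p => L; rewrite hp. Qed.

Lemma open_nonzero g : polyfun g ->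
  open_in_surjections [set L | row_full L /\ g L != 0].
Proof.
case=> p hp; exists [set L | g L = 0].
  exists [set p]; apply/seteqP; split=> L /= gL0; first by move=> _ ->; rewrite hp.
  by rewrite -hp; exact: gL0.
by apply/seteqP; split=> L /= [Lf /eqP gL].
Qed.

End Closure.

(** Along a one-parameter family of matrices with polynomial entries, non-vanishing at a single
    parameter leaves only finitely many zeros. *)
Lemma polyfun_curve m n (g : 'M[K]_(m, n) -> K) (A : 'M[{poly K}]_(m, n)) :
  polyfun g -> exists q : {poly K}, forall s, q.[s] = g (map_mx (horner_eval s) A).
Proof.
case=> p hp.
exists (\sum_(e <- msupp p) p@_e *: \prod_i (mxvec A 0 i) ^+ e i) => s.
rewrite -hp mevalE horner_sum; apply: eq_bigr => e _.
rewrite hornerZ horner_prod; congr (_ * _); apply: eq_bigr => i _.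
by rewrite horner_exp -map_mxvec mxE.
Qed.

End PolynomialFunctions.

(** * Binomial equations of the toric surface *)

Section Binomials.
Variable K : fieldType.

Lemma toric_map_binom d (t : 'rV[K]_2) j :
  toric_map (binom_matrix d) t 0 j = t 0 0 ^+ j * t 0 1 ^+ 'C(j, 2).
Proof.
rewrite mxE /binom_matrix /add_ones col_mxKd !big_ord_recl big_ord0 mulr1 !mxE /=.
by congr (_ * t 0 _ ^+ _); apply/val_inj.
Qed.

(* The third difference of j |-> (j, C(j, 2)) vanishes. *)
Definition cubic_chain d (x : 'I_d.+1 -> K) : Prop :=
  forall j, (j + 3 <= d)%N ->
    x (inord j) * x (inord (j + 2)) ^+ 3 =
    x (inord (j + 1)) ^+ 3 * x (inord (j + 3)).

Lemma toric_variety_cubic_chain d (x : 'rV[K]_d.+1) :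
  toric_variety (binom_matrix d) x -> cubic_chain (fun j => x 0 j).
Proof.
move=> Xx j jd.
pose p : {mpoly K[d.+1]} :=
  'X_(inord j) * 'X_(inord (j + 2)) ^+ 3 - 'X_(inord (j + 1)) ^+ 3 * 'X_(inord (j + 3)).
have pE (y : 'rV[K]_d.+1) : p.@[y 0] = y 0 (inord j) * y 0 (inord (j + 2)) ^+ 3 -
    y 0 (inord (j + 1)) ^+ 3 * y 0 (inord (j + 3)).
  rewrite mevalB (mevalM _ 'X_(inord j)) (mevalM _ _ 'X_(inord (j + 3))).
  by rewrite !rmorphXn /= !mevalXU.
suff : x != 0 /\ forall q, [set p] q -> q.@[x 0] = 0.
  by case=> _ /(_ p erefl)/eqP; rewrite pE subr_eq0 => /eqP.
(* The closure is the smallest closed set containing the torus image, so it suffices that the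
   hypersurface [p = 0] is closed and contains this image. *)
apply: (Xx [set y : 'rV[K]_d.+1 | y != 0 /\ forall q, [set p] q -> q.@[y 0] = 0]).
split.
  exists [set p]; split=> // q ->; exists 4%N.
  have hX i : ('X_i : {mpoly K[d.+1]}) \is 1.-homog.
    by rewrite dhomogX /= mdeg1.
  by rewrite rpredB //; [exact: (dhomogM (hX _) (dhomogMn 3 (hX _))) |
    exact: (dhomogM (dhomogMn 3 (hX _)) (hX _))].
move=> y [y0 [_ [t tT <-] [a ya]]]; split=> // q ->.
have yE i : y 0 i = a * (t 0 0 ^+ i * t 0 1 ^+ 'C(i, 2)).
  by rewrite ya mxE toric_map_binom.
apply/eqP; rewrite pE !yE !inordK; try lia; rewrite subr_eq0; apply/eqP.
rewrite !exprMn -!exprM.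
have -> : ('C(j + 2, 2) = 'C(j, 2) + j * 2 + 1)%N.
  by rewrite addn2 !binS !bin1 bin0; lia.
have -> : ('C(j + 1, 2) = 'C(j, 2) + j)%N by rewrite addn1 !binS !bin1; lia.
have -> : ('C(j + 3, 2) = 'C(j, 2) + j * 3 + 3)%N.
  by rewrite addn3 !binS !bin1 !bin0; lia.
by rewrite !mulnDl !exprD !exprM; ring.
Qed.

(** The projected torus points lie in the closure of the image, so the equivalence [M] carries them
    into the toric surface, where the binomials vanish. *)
Lemma proj_equiv_cubic_chain d r N (C : 'M[int]_(1 + r, N.+1)) (L : 'M[K]_(N.+1, d.+1)) :
  proj_equiv (proj_closure (proj_image L (toric_variety C)))
    (toric_variety (binom_matrix d)) ->
  exists2 M : 'M[K]_d.+1, M \in unitmx &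
    forall t, @torus K r t -> cubic_chain (fun j => (toric_map C t *m L *m M) 0 j).
Proof.
case=> M Mu XE; exists M => // t tT.
(* Where the projection is undefined all coordinates are zero and the binomials vanish trivially. *)
have [y0|y0] := eqVneq (toric_map C t *m L) 0.
  by move=> j _; rewrite y0 mul0mx !mxE !mul0r !expr0n mul0r.
apply: toric_variety_cubic_chain; rewrite XE.
exists (toric_map C t *m L) => // Z [_ ]; apply; split=> //.
exists (toric_map C t *m L); last by exists 1; rewrite scale1r.
exists (toric_map C t) => // Y [_ ]; apply; split.
  by apply: contraNneq y0 => ->; rewrite mul0mx.
exists (toric_map C t); last by exists 1; rewrite scale1r.
by exists t.
Qed.

End Binomials.

(** * Logarithmic derivatives *)

Section LogDerivatives.
Variable K : fieldType.
Implicit Types (p q : {poly K}) (x : K).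

Definition dlog p x := p^`().[x] / p.[x].
(** The derivative of p'/p, expanded so that no rational functions are needed. *)
Definition ddlog p x := p^`()^`().[x] / p.[x] - dlog p x ^+ 2.

Lemma dlogM p q x : p.[x] != 0 -> q.[x] != 0 ->
  dlog (p * q) x = dlog p x + dlog q x.
Proof. by move=> p0 q0; rewrite /dlog derivM hornerD !hornerM; field; rewrite p0 q0. Qed.

Lemma ddlogM p q x : p.[x] != 0 -> q.[x] != 0 ->
  ddlog (p * q) x = ddlog p x + ddlog q x.
Proof.
move=> p0 q0; rewrite /ddlog /dlog !(derivM, derivD) !(hornerD, hornerM).
by field; rewrite p0 q0.
Qed.

Lemma dlogX3 p x : p.[x] != 0 -> dlog (p ^+ 3) x = 3 * dlog p x.
Proof. by move=> p0; rewrite !exprS expr0 mulr1 !dlogM ?hornerM ?mulf_neq0 //; ring. Qed.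

Lemma ddlogX3 p x : p.[x] != 0 -> ddlog (p ^+ 3) x = 3 * ddlog p x.
Proof. by move=> p0; rewrite !exprS expr0 mulr1 !ddlogM ?hornerM ?mulf_neq0 //; ring. Qed.

Lemma dlog_chain p0 p1 p2 p3 x :
  p0.[x] != 0 -> p1.[x] != 0 -> p2.[x] != 0 -> p3.[x] != 0 ->
  p0 * p2 ^+ 3 = p1 ^+ 3 * p3 ->
  dlog p0 x + 3 * dlog p2 x = 3 * dlog p1 x + dlog p3 x /\
  ddlog p0 x + 3 * ddlog p2 x = 3 * ddlog p1 x + ddlog p3 x.
Proof.
move=> p00 p10 p20 p30 E.
have X0 p : p.[x] != 0 -> (p ^+ 3).[x] != 0 by move=> ?; rewrite horner_exp expf_neq0.
rewrite -!dlogX3 // -!ddlogX3 // -(dlogM p00 (X0 _ p20)) -(ddlogM p00 (X0 _ p20)) E.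
by rewrite (dlogM (X0 _ p10) p30) (ddlogM (X0 _ p10) p30).
Qed.

End LogDerivatives.

(** * Polynomial identities in characteristic zero and quadratic sequences *)

Section Infinite.
Variable K : numFieldType.

Lemma poly_nonroot (p : {poly K}) : p != 0 -> exists x, p.[x] != 0.
Proof.
move=> p0; pose s := [seq i%:R : K | i <- iota 0 (size p)].
have /allPn[x _ px] : ~~ all (root p) s.
  apply/negP => ps; have := max_poly_roots p0 ps.
  rewrite map_inj_uniq ?iota_uniq; last by move=> i j /eqP; rewrite eqr_nat => /eqP.
  by rewrite size_map size_iota ltnn => /(_ isT).
by exists x.
Qed.

Lemma polyP_neq0 (p q : {poly K}) : (forall x, x != 0 -> p.[x] = q.[x]) -> p = q.
Proof.
move=> pq; apply/eqP; rewrite -subr_eq0; apply/negPn/negP => pq0.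
(* The factor ['X] forces the nonroot to be nonzero. *)
have /poly_nonroot[x] : (p - q) * 'X != 0 by rewrite mulf_neq0 ?polyX_eq0.
rewrite hornerM hornerX mulf_eq0 negb_or => /andP[+ x0].
by rewrite hornerD hornerN pq // subrr eqxx.
Qed.

Definition quad (a : K * K * K) (j : nat) : K :=
  a.1.1 + a.1.2 * j%:R + a.2 * j%:R ^+ 2.

(** The recurrence says that the third difference of [u] vanishes, so [u] agrees with its Newton
    interpolation at 0, 1, 2; [c] is half the second difference at 0. *)
Lemma quad_interp d (u : nat -> K) :
  (forall j, (j + 3 <= d)%N -> u j + 3 * u (j + 2)%N = 3 * u (j + 1)%N + u (j + 3)%N) ->
  exists a, forall j, (j <= d)%N -> u j = quad a j.
Proof.
move=> hu; pose c := (u 2%N - 2 * u 1%N + u 0%N) / 2.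
exists (u 0%N, u 1%N - u 0%N - c, c).
move=> j; elim/ltn_ind: j => -[|[|[|j]]] IH jd; try by rewrite /quad /= /c; field.
have -> : u j.+3 = u j + 3 * u (j + 2)%N - 3 * u (j + 1)%N.
  by rewrite hu ?addn3 //; ring.
rewrite (IH j) ?(IH (j + 1)%N) ?(IH (j + 2)%N) //; try lia.
by rewrite /quad /= -addn3 !natrD; ring.
Qed.

(** * Moments of the coefficients along a monomial curve *)

Section Moments.
Variables (N d : nat) (c : 'M[K]_(N.+1, d.+1)).

(** With f_j(s) the sum of the c_kj s^(e_k), the moments are the values at s = 1 of f_j under s d/ds
    and its square. The first and second logarithmic derivatives of f_j for s d/ds are quadratic in
    j by the binomial equations; the second moment adds the square of the first. *)
Lemma curve_moments (e : 'I_N.+1 -> nat) :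
  (forall s, s != 0 -> cubic_chain (fun j => \sum_k s ^+ e k * c k j)) ->
  (forall j, \sum_k c k j != 0) ->
  exists a m, forall j : 'I_d.+1,
    \sum_k (e k)%:R * c k j = (\sum_k c k j) * quad a j /\
    \sum_k (e k)%:R ^+ 2 * c k j = (\sum_k c k j) * (quad a j ^+ 2 + quad m j).
Proof.
move=> chain F0.
pose f (j : 'I_d.+1) : {poly K} := \sum_k c k j *: 'X^(e k).
have fs j s : (f j).[s] = \sum_k s ^+ e k * c k j.
  by rewrite horner_sum; apply: eq_bigr => k _; rewrite hornerZ hornerXn mulrC.
have f1 j : (f j).[1] = \sum_k c k j.
  by rewrite fs; apply: eq_bigr => k _; rewrite expr1n mul1r.
have df1 j : (f j)^`().[1] = \sum_k (e k)%:R * c k j.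
  rewrite raddf_sum horner_sum; apply: eq_bigr => k _.
  by rewrite /= derivZ derivXn hornerZ hornerMn hornerXn expr1n mulrC.
(* The square of s d/ds is s^2 d^2/ds^2 + s d/ds. *)
have ddf1 j : (f j)^`()^`().[1] + (f j)^`().[1] = \sum_k (e k)%:R ^+ 2 * c k j.
  rewrite df1 !raddf_sum horner_sum -big_split; apply: eq_bigr => k _ /=.
  rewrite !derivZ derivXn derivMn derivXn hornerZ !hornerMn hornerXn expr1n.
  case: (e k) => [|i] /=; first by rewrite !mulr0n expr0n /=; ring.
  by rewrite -mulr_natr (mulrS 1 i); ring.
have frec j : (j + 3 <= d)%N -> f (inord j) * f (inord (j + 2)) ^+ 3 =
    f (inord (j + 1)) ^+ 3 * f (inord (j + 3)).
  move=> jd; apply: polyP_neq0 => s s0.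
  by rewrite !(hornerM, horner_exp) !fs; exact: chain.
have f10 j : (f j).[1] != 0 by rewrite f1.
have [a ha] : exists a, forall j, (j <= d)%N -> dlog (f (inord j)) 1 = quad a j.
  by apply: quad_interp => j jd; case: (dlog_chain (f10 _) (f10 _) (f10 _) (f10 _) (frec j jd)).
have [m hm] : exists m, forall j, (j <= d)%N ->
    ddlog (f (inord j)) 1 + dlog (f (inord j)) 1 = quad m j.
  apply: quad_interp => j jd; have [] // := dlog_chain (f10 _) (f10 _) (f10 _) (f10 _) (frec j jd).
  by move=> E1 E2; apply: etrans (etrans (congr2 +%R E1 E2) _); ring.
exists a, m => j; have jd : (j <= d)%N by rewrite -ltnS.
rewrite -f1 -df1 -ddf1 -ha // -hm // /ddlog /dlog inord_val.
by split; field.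
Qed.

End Moments.

(** * Second order jets of the projected parametrization *)

Section Jets.
Variables (N d : nat) (b : 'M[int]_(2, N.+1)).

(* The rows are the values at (1, 1) of the monomials x^(b 0 k) y^(b 1 k) and of their derivatives
   of order at most 2 with respect to x d/dx and y d/dy. *)
Definition jet1 : 'M[K]_(3, N.+1) :=
  \matrix_(i, k) [:: 1; (b 0 k)%:~R; (b 1 k)%:~R]`_i.

Definition jet2 : 'M[K]_(3, N.+1) :=
  \matrix_(i, k) [:: (b 0 k)%:~R ^+ 2; (b 0 k)%:~R * (b 1 k)%:~R; (b 1 k)%:~R ^+ 2]`_i.

(* Up to sign, the coefficients of the symbol of the Laplace equation satisfied by a surface
   in P^4. *)
Definition jet_minor m (L : 'M[K]_(N.+1, 5)) : K :=
  \det (col_mx jet1 (rowsub (lift m) jet2) *m L : 'M_(3 + 2)).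

(** Second order jets are f_j times products of two quadratics in j plus a quadratic. Their j^3 and
    j^4 coefficients come from the products alone, hence depend only on the linear and quadratic
    coefficients [x], [y] of the two logarithmic derivatives. *)
Lemma jet_factor (c : 'M[K]_(N.+1, d.+1)) :
  (forall k, 0 <= b 0 k /\ 0 <= b 1 k) ->
  (forall t, @torus K 2 t -> cubic_chain (fun j => (toric_map (add_ones b) t *m c) 0 j)) ->
  (forall j, \sum_k c k j != 0) ->
  exists (T Q0 : 'M[K]_3) (B0 : 'M[K]_(3, d.+1)) (B1 : 'M[K]_(2, d.+1)) (x y : 'rV[K]_2),
    jet1 *m c = T *m B0 /\
    jet2 *m c = Q0 *m B0 +
      (\matrix_(i, j) (if j == 0
         then [:: 2 * x 0 0 * x 0 1; x 0 0 * y 0 1 + x 0 1 * y 0 0; 2 * y 0 0 * y 0 1]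
         else [:: x 0 1 ^+ 2; x 0 1 * y 0 1; y 0 1 ^+ 2])`_i) *m B1.
Proof.
move=> b0 chain F0.
(* Restriction to the curve (s^v1, s^v2). The directions (1, 0), (0, 1) and (1, 1) determine all
   second moments by polarization. *)
have chainE (v1 v2 : nat) s : s != 0 -> cubic_chain (fun j =>
    \sum_k s ^+ (v1 * `|b 0 k| + v2 * `|b 1 k|) * c k j).
  move=> s0 j jd.
  pose t : 'rV[K]_2 := \row_i (if i == 0 then s ^+ v1 else s ^+ v2).
  have tT : @torus K 2 t by move=> i; rewrite mxE; case: ifP; rewrite expf_neq0.
  have tE i : (toric_map (add_ones b) t *m c) 0 i =
      \sum_k s ^+ (v1 * `|b 0 k| + v2 * `|b 1 k|) * c k i.
    rewrite mxE; apply: eq_bigr => k _; congr (_ * _).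
    rewrite mxE /add_ones col_mxKd !big_ord_recl big_ord0 mulr1 !mxE /=.
    rewrite (_ : lift ord0 ord0 = 1); last exact/val_inj.
    case: (b0 k); case: (b 0 k) => // n1 _; case: (b 1 k) => // n2 _ /=.
    by rewrite -!exprnP exprD !exprM.
  by have := chain t tT j jd; rewrite !tE.
have eE v1 v2 k : (v1 * `|b 0 k| + v2 * `|b 1 k|)%:R =
    v1%:R * (b 0 k)%:~R + v2%:R * (b 1 k)%:~R :> K.
  by have [x0 y0] := b0 k; rewrite natrD !natrM !natr_absz !ger0_norm.
have [ax [mx hx]] := curve_moments (chainE 1 0)%N F0.
have [ay [my hy]] := curve_moments (chainE 0 1)%N F0.
have [az [mz hz]] := curve_moments (chainE 1 1)%N F0.
pose F j := \sum_k c k j.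
have xE j : \sum_k (b 0 k)%:~R * c k j = F j * quad ax j.
  by rewrite -(hx j).1; apply: eq_bigr => k _; rewrite eE mul1r mul0r addr0.
have yE j : \sum_k (b 1 k)%:~R * c k j = F j * quad ay j.
  by rewrite -(hy j).1; apply: eq_bigr => k _; rewrite eE mul1r mul0r add0r.
have azE (j : 'I_d.+1) : quad az j = quad ax j + quad ay j.
  apply: (mulfI (F0 j)); rewrite -(hz j).1.
  apply: etrans (etrans (congr2 +%R (xE j) (yE j)) _); last exact/esym/mulrDr.
  by rewrite -big_split /=; apply: eq_bigr => k _; rewrite eE !mul1r mulrDl.
have xxE j : \sum_k (b 0 k)%:~R ^+ 2 * c k j = F j * (quad ax j ^+ 2 + quad mx j).
  by rewrite -(hx j).2; apply: eq_bigr => k _; rewrite eE mul1r mul0r addr0.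
have yyE j : \sum_k (b 1 k)%:~R ^+ 2 * c k j = F j * (quad ay j ^+ 2 + quad my j).
  by rewrite -(hy j).2; apply: eq_bigr => k _; rewrite eE mul1r mul0r add0r.
have xyE j : \sum_k ((b 0 k)%:~R * (b 1 k)%:~R) * c k j =
    F j * (quad ax j * quad ay j + (quad mz j - quad mx j - quad my j) / 2).
  transitivity ((F j * (quad az j ^+ 2 + quad mz j) - F j * (quad ax j ^+ 2 + quad mx j)
      - F j * (quad ay j ^+ 2 + quad my j)) / 2); last by rewrite azE; field.
  rewrite -(hz j).2 -xxE -yyE -!sumrB mulr_suml; apply: eq_bigr => k _.
  by rewrite eE; field.
pose l (i : nat) (a : K * K * K) := [:: a.1.1; a.1.2; a.2]`_i.
(* Coefficients of degree at most 2 in the product of the quadratics [a] and [a'] plus [m]. *)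
pose lo (a a' m : K * K * K) := (a.1.1 * a'.1.1 + m.1.1,
  a.1.1 * a'.1.2 + a.1.2 * a'.1.1 + m.1.2,
  a.1.1 * a'.2 + a.1.2 * a'.1.2 + a.2 * a'.1.1 + m.2).
pose mxy := ((mz.1.1 - mx.1.1 - my.1.1) / 2, (mz.1.2 - mx.1.2 - my.1.2) / 2,
  (mz.2 - mx.2 - my.2) / 2).
exists (\matrix_(i, j) [:: l j (1, 0, 0); l j ax; l j ay]`_i).
exists (\matrix_(i, j) [:: l j (lo ax ax mx); l j (lo ax ay mxy); l j (lo ay ay my)]`_i).
exists (\matrix_(i, j) (j%:R ^+ i * F j)), (\matrix_(i, j) (j%:R ^+ (3 + i) * F j)).
exists (\row_i (if i == 0 then ax.1.2 else ax.2)), (\row_i (if i == 0 then ay.1.2 else ay.2)).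
split; apply/matrixP => i j.
  transitivity (F j * [:: 1; quad ax j; quad ay j]`_i).
    rewrite mxE; under eq_bigr do rewrite mxE.
    case: i => [[|[|[|//]]] ?] /=; rewrite ?xE ?yE // mulr1.
    by apply: eq_bigr => k _; rewrite mul1r.
  rewrite mxE !big_ord_recl big_ord0 !mxE /l /=.
  by case: i => [[|[|[|//]]] ?]; rewrite /quad /bump /=; ring.
transitivity (F j * [:: quad ax j ^+ 2 + quad mx j;
    quad ax j * quad ay j + (quad mz j - quad mx j - quad my j) / 2;
    quad ay j ^+ 2 + quad my j]`_i).
  rewrite mxE; under eq_bigr do rewrite mxE.
  by case: i => [[|[|[|//]]] ?] /=; rewrite ?xxE ?xyE ?yyE.
rewrite [RHS]mxE [X in _ = X + _]mxE [X in _ = _ + X]mxE !big_ord_recl !big_ord0 !mxE /l /=.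
by case: i => [[|[|[|//]]] ?]; rewrite /quad /bump /mxy /=; field.
Qed.

End Jets.
End Infinite.

(** * Vanishing of the jet discriminant *)

Lemma det_mx22 (R : comPzRingType) (A : 'M[R]_2) :
  \det A = A 0 0 * A 1 1 - A 0 1 * A 1 0.
Proof.
rewrite (expand_det_row _ 0) !big_ord_recl big_ord0 /cofactor !det_mx11 !mxE /=.
rewrite (_ : lift ord0 ord0 = 1); last exact/val_inj.
rewrite (_ : lift 1 0 = 0); last exact/val_inj.
by rewrite /bump /=; ring.
Qed.

Section Discriminant.
Variables (K : numFieldType) (N d : nat) (b : 'M[int]_(2, N.+1)).
Hypothesis b0 : forall k, 0 <= b 0 k /\ 0 <= b 1 k.

(** The jet matrix is a block triangular matrix times a common 5 x 5 factor, so its minors are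
    proportional to the 2 x 2 minors of [Q]. With D = x0 y1 - x1 y0 these are y1^2 D, 2 x1 y1 D and
    x1^2 D, which satisfy the discriminant relation. *)
Lemma jet_minors (c : 'M[K]_(N.+1, d.+1)) (P : 'M[K]_(d.+1, 5)) :
  (forall t, @torus K 2 t -> cubic_chain (fun j => (toric_map (add_ones b) t *m c) 0 j)) ->
  (forall j, \sum_k c k j != 0) ->
  jet_minor b 1 (c *m P) ^+ 2 = 4 * jet_minor b 0 (c *m P) * jet_minor b 2 (c *m P).
Proof.
move=> chain F0; have [T [Q0 [B0 [B1 [x [y [E1 E2]]]]]]] := jet_factor b0 chain F0.
set Q := (\matrix_(i, j) _) in E2.
have mE m : jet_minor b m (c *m P) =
    \det T * \det (rowsub (lift m) Q) * \det (col_mx B0 B1 *m P : 'M_(3 + 2)).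
  rewrite -(det_lblock T (rowsub (lift m) Q0)) -det_mulmx; congr (\det _).
  rewrite mulmxA mul_col_mx E1 mul_rowsub_mx E2.
  by rewrite (mulmxA (block_mx _ _ _ _)) mul_block_col mul0mx addr0 linearD /= !mul_rowsub_mx.
rewrite !mE !det_mx22 !mxE /=.
ring.
Qed.

Variable g : 'I_5 -> 'I_d.+1.

(** The map [g] selects five coordinates, that is, a further projection to P^4. *)
Definition jet_disc (L : 'M[K]_(N.+1, d.+1)) : K :=
  jet_minor b 1 (colsub g L) ^+ 2 -
  4 * jet_minor b 0 (colsub g L) * jet_minor b 2 (colsub g L).

Lemma polyfun_jet_disc : polyfun jet_disc.
Proof.
have minor m : polyfun (fun L : 'M[K]_(N.+1, d.+1) => jet_minor b m (colsub g L)).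
  apply: polyfun_det => i j; apply: polyfun_ext (polyfun_mulmxl _ i (g j) _).
    by move=> L; rewrite mulmx_colsub [RHS]mxE.
  by move=> k l; exact: polyfun_entry.
apply: polyfunB; first exact: polyfunX.
by apply: polyfunM => //; apply: polyfunM => //; exact: polyfun_cst.
Qed.

Hypothesis bd : forall k, b 0 k <= d%:Z.
Hypothesis b_inj : injective (fun k => col k b).

(** The relation between the minors requires all coordinates of the parametrization to be nonzero at
    (1, 1). A torus translation by (s, s^(d+1)) with generic s achieves this and keeps a nonzero
    discriminant nonzero. *)
Lemma jet_disc_eq0 (L : 'M[K]_(N.+1, d.+1)) (M : 'M[K]_d.+1) :
  row_full L -> M \in unitmx ->
  (forall t, @torus K 2 t ->
     cubic_chain (fun j => (toric_map (add_ones b) t *m L *m M) 0 j)) ->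
  jet_disc L = 0.
Proof.
move=> Lf Mu chain; apply/eqP/negPn/negP => disc0.
(* Exponent of s in the k-th monomial at (s, s^(d+1)). It determines the lattice point because the
   first coordinate is a digit in base d+1. *)
pose e k := (`|b 0%R k| + d.+1 * `|b 1%R k|)%N.
have e_inj : injective e.
  move=> k l ekl.
  have lt_d m : (`|b 0%R m| < d.+1)%N by have := b0 m; have := bd m; lia.
  have E1 := congr1 (modn^~ d.+1) ekl; have E2 := congr1 (divn^~ d.+1) ekl.
  rewrite /e /= ![(_ + d.+1 * _)%N]addnC ![(d.+1 * _)%N]mulnC in E1 E2.
  rewrite !modnMDl !modn_small // in E1; rewrite !divnMDl // !divn_small // !addn0 in E2.
  apply: b_inj; apply/colP => i; rewrite !mxE.
  have [->|->] : i = 0 \/ i = 1.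
    by case: i => [[|[|//]] ?]; [left|right]; exact/val_inj.
  - by have := b0 k; have := b0 l; lia.
  - by have := b0 k; have := b0 l; lia.
have e0 k s : s != 0 -> s ^+ e k = s ^ (b 0 k) * (s ^+ d.+1) ^ (b 1 k) :> K.
  move=> s0; rewrite /e; case: (b0 k); case: (b 0 k) => // n1 _.
  by case: (b 1 k) => // n2 _; rewrite exprD exprM.
(* [q] is the discriminant of the translate of [L] by s; its value at s = 1 is that of [L]
   itself. *)
have [q qE] := polyfun_curve (\matrix_(k, j) (L k j *: 'X^(e k))) polyfun_jet_disc.
have LE s : map_mx (horner_eval s) (\matrix_(k, j) (L k j *: 'X^(e k))) =
    \matrix_(k, j) (s ^+ e k * L k j).
  by apply/matrixP => k j; rewrite !mxE /horner_eval hornerZ hornerXn mulrC.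
have q0 : q != 0.
  apply: contraNneq disc0 => q0; have := qE 1; rewrite q0 horner0 LE => /esym/eqP.
  by congr (jet_disc _ == 0); apply/matrixP => k j; rewrite mxE expr1n mul1r.
(* Coordinate j of the translated parametrization at (1, 1); distinct exponents exclude
   cancellation. *)
pose h j : {poly K} := \sum_k (L *m M) k j *: 'X^(e k).
have h0 j : h j != 0.
  have /row_fullP[V VLM] : row_full (L *m M).
    by rewrite /row_full mxrankMfree ?row_free_unit.
  have [k LMk] : exists k, (L *m M) k j != 0.
    apply/existsP; apply: contraT; rewrite negb_exists => /forallP LMj.
    have /eqP := congr1 (fun A : 'M[K]_d.+1 => A j j) VLM.
    rewrite !mxE eqxx big1 ?(eq_sym 0) ?oner_eq0 // => k _.
    by have := LMj k; rewrite negbK => /eqP ->; rewrite mulr0.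
  apply: contraNneq LMk => hj0; have := congr1 (fun p : {poly K} => p`_(e k)) hj0.
  rewrite coef0 coef_sum (bigD1 k) //= coefZ coefXn eqxx mulr1 big1 ?addr0 => [->//|l lk].
  by rewrite coefZ coefXn (inj_eq e_inj) eq_sym (negPf lk) mulr0.
have /poly_nonroot[s] : q * \prod_j h j * 'X != 0.
  by rewrite !mulf_neq0 ?polyX_eq0 //; apply/prodf_neq0.
rewrite !hornerM hornerX horner_prod !mulf_eq0 !negb_or -andbA => /and3P[qs /prodf_neq0 hs s0].
pose Ls : 'M[K]_(N.+1, d.+1) := \matrix_(k, j) (s ^+ e k * L k j).
have LsM k j : (Ls *m M) k j = s ^+ e k * (L *m M) k j.
  by rewrite !mxE mulr_sumr; apply: eq_bigr => i _; rewrite mxE mulrA.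
have F0 j : \sum_k (Ls *m M) k j != 0.
  have := hs j isT; rewrite horner_sum; congr (_ != 0); apply: eq_bigr => k _.
  by rewrite hornerZ hornerXn LsM mulrC.
have chains t : @torus K 2 t ->
    cubic_chain (fun j => (toric_map (add_ones b) t *m (Ls *m M)) 0 j).
  move=> tT j jd.
  pose u : 'rV[K]_2 := \row_i (t 0 i * (if i == 0 then s else s ^+ d.+1)).
  have uT : @torus K 2 u.
    by move=> i; rewrite mxE mulf_neq0 //; case: ifP; rewrite ?expf_neq0.
  have uE : toric_map (add_ones b) t *m (Ls *m M) = toric_map (add_ones b) u *m L *m M.
    rewrite -mulmxA; apply/rowP => i; rewrite mxE [RHS]mxE; apply: eq_bigr => k _.
    rewrite LsM mulrA; congr (_ * _); rewrite e0 // !mxE /add_ones col_mxKd.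
    rewrite !big_ord_recl !big_ord0 !mulr1 !mxE /= !exprzMl ?unitfE ?expf_neq0 //.
    rewrite (_ : lift ord0 ord0 = 1); last exact/val_inj.
    by rewrite !mulrA; congr (_ * _); rewrite mulrAC.
  by have := chain u uT j jd; rewrite -uE.
(* The factor [invmx M] undoes the change of coordinates, so that the relation concerns the
   translate of [L] alone. *)
have /eqP := jet_minors (invmx M *m colsub g 1%:M) chains F0.
rewrite mulmxA mulmxK // mulmx_colsub mulmx1 -subr_eq0 -/(jet_disc Ls).
by have -> : jet_disc Ls = q.[s] by [rewrite qE LE]; rewrite (negPf qs).
Qed.

End Discriminant.

(** * Lattice points of the polygon *)

Section LatticePoints.
Variables (R : realType) (d : nat).

(** An affine function nonnegative at the generating points is nonnegative on their convex hull. *)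
Lemma lattice_point_ineq (x : 'cV[int]_2) (u v w : int) :
  binom_lattice_points R d x ->
  (forall j, (j <= d)%N -> 0 <= u + v * j%:Z + w * 'C(j, 2)%:Z) ->
  0 <= u + v * x 0 0 + w * x 1 0.
Proof.
case=> c [c0 c1 xE] h.
have xiE i : (x i 0)%:~R = \sum_j (binom_points d i j)%:~R * c j 0 :> R.
  have := congr1 (fun A : 'cV[R]_2 => A i 0) xE; rewrite !mxE => ->.
  by apply: eq_bigr => j _; rewrite mxE.
have uE : u%:~R = \sum_j u%:~R * c j 0 :> R by rewrite -mulr_sumr c1 mulr1.
rewrite -(ler_int R) !intrD !intrM !xiE uE !mulr_sumr -!big_split /=.
apply: sumr_ge0 => j _; rewrite !mxE /= !mulrA -!mulrDl mulr_ge0 //.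
by have := h j (ltn_ord j); rewrite -(ler_int R) !intrD !intrM.
Qed.

Lemma lattice_point_segment (x : 'cV[int]_2) j m n : (j <= d)%N -> (m <= n)%N -> (0 < n)%N ->
  n%:Z * x 0 0 = m%:Z * j%:Z -> n%:Z * x 1 0 = m%:Z * 'C(j, 2)%:Z ->
  binom_lattice_points R d x.
Proof.
move=> jd mn n0 x0 x1; have nR0 : n%:R != 0 :> R by rewrite pnatr_eq0 -lt0n.
pose l : R := m%:R / n%:R.
(* The point divides the segment from the origin, which is generating point 0, to generating point j
   in the ratio given by l = m/n. *)
exists ((1 - l) *: delta_mx 0 0 + l *: delta_mx (inord j) 0); split.
- move=> i; rewrite !mxE; apply: addr_ge0; apply: mulr_ge0; rewrite ?ler0n //.
    by rewrite subr_ge0 ler_pdivrMr ?ltr0n // mul1r ler_nat.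
  by rewrite divr_ge0.
- under eq_bigr do rewrite !mxE !andbT.
  rewrite big_split /= -!mulr_sumr (bigD1 0) //= big1 ?addr0; last by move=> i /negPf ->.
  rewrite (bigD1 (inord j)) //= big1 ?addr0; last by move=> i /negPf ->.
  by rewrite !eqxx /=; ring.
rewrite mulmxDr -!scalemxAr -!colE; apply/colP => i; rewrite !mxE /= inordK //.
have xE i' c : n%:Z * x i' 0 = m%:Z * c -> (x i' 0)%:~R = l * c%:~R :> R.
  move=> /(congr1 (fun z : int => z%:~R : R)); rewrite !intrM => E.
  by apply: (mulfI nR0); rewrite E /l; field.
have [->|->] : i = 0 \/ i = 1.
  by case: i => [[|[|//]] ?]; [left|right]; exact/val_inj.
- by rewrite (xE 0 _ x0) /=; ring.
- by rewrite (xE 1 _ x1) bin0n /=; ring.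
Qed.

End LatticePoints.

(** * Coordinate projections and a nonzero discriminant for d >= 4 *)

Section Selection.
Variables (K : numFieldType) (N n : nat) (s : 'I_n -> 'I_N.+1).

Definition selection_mx : 'M[K]_(N.+1, n) := \matrix_(k, j) (k == s j)%:R.

Lemma mulmx_selection m (A : 'M[K]_(m, N.+1)) : A *m selection_mx = colsub s A.
Proof.
apply/matrixP => i j; rewrite !mxE (bigD1 (s j)) //= mxE eqxx mulr1 big1 ?addr0 // => k sk.
by rewrite mxE (negPf sk) mulr0.
Qed.

Lemma row_full_selection : injective s -> row_full selection_mx.
Proof.
move=> s_inj; apply/row_fullP; exists selection_mx^T.
by apply/matrixP => i j; rewrite mulmx_selection !mxE (inj_eq s_inj) eq_sym.
Qed.

End Selection.

Section DiscriminantNonzero.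
Variables (R : realType) (K : numFieldType) (d N : nat) (b : 'M[int]_(2, N.+1)).
Hypothesis hd : (4 <= d)%N.
Hypothesis hb : enum_lattice_points R d b.

(* The first five points lie on the conic y (x - 2) = 0 and on no other one. *)
Definition sample_point (j : nat) : nat * nat :=
  match j with 3 => (2, 2) | 4 => (2, 3) | _ => (j, 'C(j, 2)) end%N.

Lemma sample_index : exists2 s : 'I_d.+1 -> 'I_N.+1, injective s &
  forall j, b 0 (s j) = (sample_point j).1%:Z /\ b 1 (s j) = (sample_point j).2%:Z.
Proof.
have [b_inj bE] := hb.
have [s sE] : exists s : 'I_d.+1 -> 'I_N.+1, forall j,
    b 0 (s j) = (sample_point j).1%:Z /\ b 1 (s j) = (sample_point j).2%:Z.
  apply: (@fin_all_exists _ _ (fun (j : 'I_d.+1) (k : 'I_N.+1) =>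
    b 0 k = (sample_point j).1%:Z /\ b 1 k = (sample_point j).2%:Z)) => j.
  pose x : 'cV[int]_2 := \col_i (if i == 0 then (sample_point j).1 else (sample_point j).2)%:Z.
  have : binom_lattice_points R d x.
    have jd : (j <= d)%N by rewrite -ltnS.
    have gen : x 0 0 = j%:Z -> x 1 0 = 'C(j, 2)%:Z -> binom_lattice_points R d x.
      move=> x0 x1.
      by apply: (@lattice_point_segment R d x j 1 1) => //; rewrite ?x0 ?x1.
    move: gen; rewrite !mxE /= /sample_point.
    case jE: (nat_of_ord j) => [|[|[|[|[|i]]]]] gen; try exact: gen.
      (* (2, 2) is two thirds of (3, 3), and (2, 3) below is half of (4, 6). *)
      by apply: (@lattice_point_segment R d x 3 2 3); rewrite ?mxE ?jE //; exact: ltnW.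
    by apply: (@lattice_point_segment R d x 4 1 2); rewrite ?mxE ?jE.
  rewrite -bE => -[k _ kE]; exists k.
  by have := congr1 (fun A : 'cV_2 => A 0 0) kE; have := congr1 (fun A : 'cV_2 => A 1 0) kE;
    rewrite !mxE.
exists s => // i j sij; apply: ord_inj.
have [] := sE j; rewrite -sij; have [-> ->] := sE i; rewrite /sample_point.
case: (nat_of_ord i) => [|[|[|[|[|i']]]]]; case: (nat_of_ord j) => [|[|[|[|[|j']]]]] //=.
all: by move=> e1 e2; rewrite ?binn in e2; lia.
Qed.

(** For the projection onto the sample points the minors are evaluation determinants of 1, x, y and
    two of x^2, xy, y^2. The conic xy - 2y kills the two minors involving xy. The third is nonzero,
    no conic without an xy term passing through the five points. *)
Lemma exists_jet_disc_neq0 : exists g : 'I_5 -> 'I_d.+1,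
  exists2 L : 'M[K]_(N.+1, d.+1), row_full L & jet_disc b g L != 0.
Proof.
have [s s_inj sE] := sample_index.
pose g : 'I_5 -> 'I_d.+1 := widen_ord (hd : 4 < d.+1)%N.
exists g, (selection_mx K s); first exact: row_full_selection.
pose phi (m : 'I_3) (i : nat) (p : nat * nat) : K :=
  [:: 1; p.1%:R; p.2%:R;
      [:: p.1%:R ^+ 2; p.1%:R * p.2%:R; p.2%:R ^+ 2]`_(bump m 0);
      [:: p.1%:R ^+ 2; p.1%:R * p.2%:R; p.2%:R ^+ 2]`_(bump m 1)]`_i.
have minorE m : jet_minor b m (colsub g (selection_mx K s)) =
    \det (\matrix_(i < 5, j < 5) phi m i (sample_point j)).
  rewrite /jet_minor mulmx_colsub mulmx_selection; congr (\det _).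
  apply/matrixP => i j; rewrite !mxE; have [xE yE] := sE (g j).
  by case: splitP => i' iE; rewrite !mxE xE yE iE;
    [case: i' {iE} => [[|[|[|//]]] ?] | case: i' {iE} => [[|[|//]] ?]].
have singular m (v : 'rV[K]_5) : v != 0 ->
    (forall j : 'I_5, \sum_i v 0 i * phi m i (sample_point j) = 0) ->
    jet_minor b m (colsub g (selection_mx K s)) = 0.
  move=> v0 vE; apply/eqP; rewrite minorE; apply/det0P; exists v => //.
  by apply/rowP => j; rewrite !mxE -[RHS](vE j); apply: eq_bigr => i _; rewrite mxE.
have m0 : jet_minor b 0 (colsub g (selection_mx K s)) = 0.
  apply: (singular _ (\row_i [:: 0; 0; -2; 1; 0]`_i)).
    by apply/eqP => /rowP/(_ (inord 3)); rewrite !mxE inordK //= => /eqP; rewrite oner_eq0.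
  move=> j; rewrite !big_ord_recl big_ord0 !mxE /phi /=.
  by case: j => [[|[|[|[|[|//]]]]] ?] /=; rewrite ?bin0n ?(@bin_small 1 2) ?binn //=; ring.
have m2 : jet_minor b 2 (colsub g (selection_mx K s)) = 0.
  have -> : 2 = ord_max :> 'I_3 by exact/val_inj.
  apply: (singular _ (\row_i [:: 0; 0; -2; 0; 1]`_i)).
    by apply/eqP => /rowP/(_ (inord 4)); rewrite !mxE inordK //= => /eqP; rewrite oner_eq0.
  move=> j; rewrite !big_ord_recl big_ord0 !mxE /phi /=.
  by case: j => [[|[|[|[|[|//]]]]] ?] /=; rewrite ?bin0n ?(@bin_small 1 2) ?binn //=; ring.
rewrite /jet_disc m0 m2 !mulr0 subr0 expf_neq0 // minorE.
apply/det0P => -[v /eqP v0 vE]; apply: v0.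
pose S (j : 'I_5) := \sum_i v 0 i * phi 1 i (sample_point j).
have S0 j : S j = 0.
  have := congr1 (fun A : 'rV_5 => A 0 j) vE; rewrite !mxE => E0; rewrite -[RHS]E0.
  by apply: eq_bigr => i _; rewrite mxE.
pose a i := v 0 (inord i : 'I_5).
have SE j : S j = a 0%N + a 1%N * (sample_point j).1%:R + a 2%N * (sample_point j).2%:R +
    a 3%N * (sample_point j).1%:R ^+ 2 + a 4%N * (sample_point j).2%:R ^+ 2.
  rewrite /S !big_ord_recl big_ord0 /phi /= /a.
  have vi (i : 'I_5) : v 0 i = v 0 (inord i) by rewrite inord_val.
  by do ![rewrite [v 0 (lift _ _)]vi /=]; rewrite [v 0 ord0]vi /=; ring.
pose S' i := S (inord i); have S'0 i : S' i = 0 by exact: S0.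
have c12 : 'C(1, 2) = 0%N by [].
(* The coefficients of such a conic are recovered from its values by differences, first along the
   line x = 2. *)
have a4 : a 4%N = (S' 4%N - 2 * S' 3%N + S' 2%N) / 2.
  by rewrite /S' !SE /sample_point !inordK //= ?bin0n ?c12 ?binn /=; field.
have a2 : a 2%N = S' 3%N - S' 2%N - 3 * a 4%N.
  by rewrite /S' !SE /sample_point !inordK //= ?bin0n ?c12 ?binn /=; ring.
have a0 : a 0%N = S' 0%N.
  by rewrite /S' !SE /sample_point !inordK //= ?bin0n ?c12 ?binn /=; ring.
have a3 : a 3%N = (S' 2%N + a 0%N - a 2%N - a 4%N - 2 * S' 1%N) / 2.
  by rewrite /S' !SE /sample_point !inordK //= ?bin0n ?c12 ?binn /=; field.
have a1 : a 1%N = S' 1%N - a 0%N - a 3%N.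
  by rewrite /S' !SE /sample_point !inordK //= ?bin0n ?c12 ?binn /=; ring.
rewrite !S'0 in a0 a1 a2 a3 a4.
apply/rowP => i; rewrite mxE (_ : v 0 i = a i); last by rewrite /a inord_val.
case: i => [[|[|[|[|[|//]]]]] ?] /=.
all: by rewrite ?a1 ?a3 ?a2 ?a4 ?a0; field.
Qed.

End DiscriminantNonzero.

(** * Case d = 3: binomial equation between linear forms in x *)

(** The hypotheses are the coefficients in x of f0 f2^3 = f1^3 f3 with f_j = p_j + x q_j. At the
    root of f2 the right side vanishes to order 3; if f1 did not vanish there, the linear form f3
    would be zero. *)
Lemma linear_chain_cross (A : idomainType) (p0 p1 p2 p3 q0 q1 q2 q3 : A) :
  p0 * p2 ^+ 3 = p1 ^+ 3 * p3 ->
  q0 * p2 ^+ 3 + 3 * p0 * p2 ^+ 2 * q2 = 3 * p1 ^+ 2 * q1 * p3 + p1 ^+ 3 * q3 ->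
  3 * q0 * p2 ^+ 2 * q2 + 3 * p0 * p2 * q2 ^+ 2 =
    3 * p1 * q1 ^+ 2 * p3 + 3 * p1 ^+ 2 * q1 * q3 ->
  3 * q0 * p2 * q2 ^+ 2 + p0 * q2 ^+ 3 = q1 ^+ 3 * p3 + 3 * p1 * q1 ^+ 2 * q3 ->
  q0 * q2 ^+ 3 = q1 ^+ 3 * q3 ->
  (p3 != 0) || (q3 != 0) ->
  p1 * q2 = p2 * q1.
Proof.
move=> /eqP; rewrite -subr_eq0; set e0 := (X in X == 0) => /eqP E0.
move=> /eqP; rewrite -subr_eq0; set e1 := (X in X == 0) => /eqP E1.
move=> /eqP; rewrite -subr_eq0; set e2 := (X in X == 0) => /eqP E2.
move=> /eqP; rewrite -subr_eq0; set e3 := (X in X == 0) => /eqP E3.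
move=> /eqP; rewrite -subr_eq0; set e4 := (X in X == 0) => /eqP E4 f3.
apply/eqP; rewrite -subr_eq0; set w := p1 * q2 - p2 * q1.
(* The homogenized equation at (q2, -p2), the root of f2; [Wp] and [Wq] come from its two partial
   derivatives there. *)
have W : w ^+ 3 * (p3 * q2 - q3 * p2) = 0.
  transitivity (- (e0 * q2 ^+ 4 - e1 * q2 ^+ 3 * p2 + e2 * q2 ^+ 2 * p2 ^+ 2 - e3 * q2 * p2 ^+ 3 +
    e4 * p2 ^+ 4)); first by rewrite /w /e0 /e1 /e2 /e3 /e4; ring.
  by rewrite E0 E1 E2 E3 E4; ring.
apply/negPn/negP => w0; have w30 : w ^+ 3 != 0 by rewrite expf_neq0.
have {}W : p3 * q2 - q3 * p2 = 0 by apply: (mulfI w30); rewrite W mulr0.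
have Wp : w ^+ 3 * p3 = 0.
  transitivity (- (4 * e0 * q2 ^+ 3 - 3 * e1 * q2 ^+ 2 * p2 + 2 * e2 * q2 * p2 ^+ 2 - e3 * p2 ^+ 3) -
     3 * w ^+ 2 * p1 * (p3 * q2 - q3 * p2)); first by rewrite /w /e0 /e1 /e2 /e3 /e4; ring.
  by rewrite E0 E1 E2 E3 W; ring.
have Wq : w ^+ 3 * q3 = 0.
  transitivity (- (e1 * q2 ^+ 3 - 2 * e2 * q2 ^+ 2 * p2 + 3 * e3 * q2 * p2 ^+ 2 - 4 * e4 * p2 ^+ 3) -
     3 * w ^+ 2 * q1 * (p3 * q2 - q3 * p2)); first by rewrite /w /e0 /e1 /e2 /e3 /e4; ring.
  by rewrite E1 E2 E3 E4 W; ring.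
have p30 : p3 = 0 by apply: (mulfI w30); rewrite Wp mulr0.
have q30 : q3 = 0 by apply: (mulfI w30); rewrite Wq mulr0.
by rewrite p30 q30 eqxx in f3.
Qed.

(** * Linear polynomials and ratios of cubes *)

Section LinearPolynomials.
Variable K : fieldType.
Implicit Types (a b c d : K) (p q : {poly K}).

Definition lin a c : {poly K} := a%:P + c *: 'X.

Lemma horner_lin a c x : (lin a c).[x] = a + c * x.
Proof. by rewrite hornerD hornerC hornerZ hornerX. Qed.

Lemma size_lin a c : (size (lin a c) <= 2)%N.
Proof.
apply: leq_trans (size_polyD _ _) _; rewrite geq_max.
by rewrite (leq_trans (size_polyC_leq1 a)) // (leq_trans (size_scale_leq _ _)) ?size_polyX.
Qed.

Lemma lin_eq0 a c : (lin a c == 0) = (a == 0) && (c == 0).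
Proof.
apply/eqP/andP => [E|[/eqP -> /eqP ->]]; last by rewrite /lin scale0r addr0.
have := congr1 (fun p : {poly K} => p`_0) E; have := congr1 (fun p : {poly K} => p`_1) E.
by rewrite !(coef0, coefD, coefC, coefZ, coefX) /= mulr0 mulr1 addr0 add0r => -> ->.
Qed.

Lemma size_lin_nonconst a c : c != 0 -> size (lin a c) = 2%N.
Proof.
move=> c0; rewrite /lin addrC size_polyDl size_scale ?size_polyX //.
by rewrite ltnS size_polyC_leq1.
Qed.

Lemma coprimep_lin a b c d : a * d != b * c -> coprimep (lin a c) (lin b d).
Proof.
move=> D; apply/Bezout_coprimepP; exists (d%:P, - c%:P) => /=.
rewrite (_ : _ + _ = (a * d - b * c)%:P); first by rewrite -polyC1 polyC_eqp1 subr_eq0.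
by rewrite /lin rmorphB !rmorphM /= -!mul_polyC; ring.
Qed.

(** At the root of [lin a c] the left side has multiplicity 1 modulo 3, while the right side has
    multiplicity 0 modulo 3 unless [lin b d] vanishes there too. *)
Lemma lin_cube_ratio_nonconst a b c d p q : p != 0 -> q != 0 -> c != 0 ->
  lin a c * q ^+ 3 = p ^+ 3 * lin b d -> a * d = b * c.
Proof.
move=> p0 q0 c0 E; apply/eqP/negPn/negP => D; pose z := - a / c.
have mu1 : mup z (lin a c) = 1%N.
  have -> : lin a c = c%:P * ('X - z%:P) ^+ 1.
    rewrite /lin expr1 mulrBr -polyCM mul_polyC addrC -polyCN.
    by congr (_ + _%:P); rewrite /z; field.
  by rewrite mupMr ?mup_XsubCX ?eqxx // rootC.
have l0 : lin a c != 0 by rewrite lin_eq0 (negPf c0) andbF.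
have lz : ~~ root (lin b d) z.
  rewrite rootE horner_lin; apply: contra D => /eqP E'.
  by rewrite -subr_eq0 -[X in X == 0]opprK oppr_eq0 -(mulr0 c) -E' /z; apply/eqP; field.
have := congr1 (mup z) E.
rewrite mupM ?expf_neq0 // mupMl // mu1 !exprS expr0 !mupM ?mulf_neq0 ?oner_neq0 //.
by rewrite (mupNroot (root1 z)); lia.
Qed.

Lemma lin_cube_ratio a b c d p q : p != 0 -> q != 0 ->
  lin a c * q ^+ 3 = p ^+ 3 * lin b d -> a * d = b * c.
Proof.
move=> p0 q0 E; have [c0|c0] := eqVneq c 0.
  have [d0|d0] := eqVneq d 0; first by rewrite c0 d0 !mulr0.
  by apply/esym; apply: (lin_cube_ratio_nonconst q0 p0 d0); rewrite mulrC -E mulrC.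
exact: lin_cube_ratio_nonconst p0 q0 c0 E.
Qed.

(** By coprimality [q1 ^+ 3] divides [p], and the cofactor is shared by [q]; since one of [q1], [q2]
    has degree 1, the degree bound makes it constant. *)
Lemma coprime_cube_ratio p q q1 q2 : coprimep q1 q2 -> q1 != 0 -> q2 != 0 ->
  (size p <= 4)%N -> (size q <= 4)%N -> (size q1 == 2)%N || (size q2 == 2)%N ->
  p * q2 ^+ 3 = q1 ^+ 3 * q -> exists r, p = r *: q1 ^+ 3 /\ q = r *: q2 ^+ 3.
Proof.
move=> co q10 q20 sp sq s12 E.
have [s pE] : exists s, p = s * q1 ^+ 3.
  have /dvdpP : q1 ^+ 3 %| p.
    by rewrite -(@Gauss_dvdpl _ p (q2 ^+ 3)) ?coprimep_expl ?coprimep_expr // E dvdp_mulr.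
  by [].
have qE : q = s * q2 ^+ 3.
  by apply: (mulfI (expf_neq0 3 q10)); rewrite -E pE; ring.
have s1 : (size s <= 1)%N.
  have [->|s0] := eqVneq s 0; first by rewrite size_poly0.
  have sz (r : {poly K}) : r != 0 -> size r = 2%N ->
      (size (s * r ^+ 3)%R <= 4)%N -> (size (s : {poly K}) <= 1)%N.
    move=> r0 r2; have r3 : size (r ^+ 3) = 4%N.
      by rewrite -[LHS]prednK ?size_exp ?r2 // size_poly_gt0 expf_neq0.
    by rewrite size_mul ?expf_neq0 // r3 addnC.
  by case/orP: s12 => /eqP; [move/(sz _ q10) | move/(sz _ q20)]; apply; rewrite -?pE -?qE.
exists s`_0; rewrite -!mul_polyC -size1_polyC //.
Qed.

End LinearPolynomials.

(** * The scroll discriminant and its vanishing *)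

(** Laplace expansion along the first two rows. *)
Lemma det_mx44 (A : comPzRingType) (f : nat -> nat -> A) :
  \det (\matrix_(i < 4, j < 4) f i j) =
    (f 0 0 * f 1 1 - f 0 1 * f 1 0) * (f 2 2 * f 3 3 - f 2 3 * f 3 2) -
    (f 0 0 * f 1 2 - f 0 2 * f 1 0) * (f 2 1 * f 3 3 - f 2 3 * f 3 1) +
    (f 0 0 * f 1 3 - f 0 3 * f 1 0) * (f 2 1 * f 3 2 - f 2 2 * f 3 1) +
    (f 0 1 * f 1 2 - f 0 2 * f 1 1) * (f 2 0 * f 3 3 - f 2 3 * f 3 0) -
    (f 0 1 * f 1 3 - f 0 3 * f 1 1) * (f 2 0 * f 3 2 - f 2 2 * f 3 0) +
    (f 0 2 * f 1 3 - f 0 3 * f 1 2) * (f 2 0 * f 3 1 - f 2 1 * f 3 0).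
Proof.
rewrite (@expand_det_row _ 4 _ 0) !big_ord_recl big_ord0 /cofactor.
rewrite !(@expand_det_row _ 3 _ 0) !big_ord_recl !big_ord0 /cofactor !det_mx22 !mxE /= /bump /=.
ring.
Qed.

Section Scroll.
Variable K : numFieldType.

Definition cubic (a b c d : K) : {poly K} := Poly [:: a; b; c; d].

Lemma horner_cubic a b c d x : (cubic a b c d).[x] = a + b * x + c * x ^+ 2 + d * x ^+ 3.
Proof. by rewrite horner_Poly /=; ring. Qed.

Lemma cubic_inj a b c d a' b' c' d' : cubic a b c d = cubic a' b' c' d' ->
  [/\ a = a', b = b', c = c' & d = d'].
Proof.
move=> E; have Ei i := congr1 (fun p : {poly K} => p`_i) E.
by split; [have := Ei 0%N | have := Ei 1%N | have := Ei 2%N | have := Ei 3%N];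
  rewrite !coef_Poly.
Qed.

Lemma size_cubic a b c d : (size (cubic a b c d) <= 4)%N.
Proof. exact: size_Poly. Qed.

Lemma scale_lin_cube (r a c : K) :
  r *: lin a c ^+ 3 = cubic (r * a ^+ 3) (r * 3 * a ^+ 2 * c) (r * 3 * a * c ^+ 2) (r * c ^+ 3).
Proof.
apply: polyP_neq0 => x _.
by rewrite horner_cubic hornerZ horner_exp horner_lin; ring.
Qed.

Lemma scale_cubic r a b c d : r *: cubic a b c d = cubic (r * a) (r * b) (r * c) (r * d).
Proof. by apply: polyP_neq0 => x _; rewrite hornerZ !horner_cubic; ring. Qed.

Lemma scale_lin (r a c : K) : r *: lin a c = lin (r * a) (r * c).
Proof. by apply: polyP_neq0 => x _; rewrite hornerZ !horner_lin; ring. Qed.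

Lemma lin_inj (a b a' b' : K) : lin a b = lin a' b' -> a = a' /\ b = b'.
Proof.
move=> /eqP; rewrite -subr_eq0 (_ : _ - _ = @lin K (a - a') (b - b')).
  by rewrite lin_eq0 !subr_eq0 => /andP[/eqP -> /eqP ->].
by apply: polyP_neq0 => x _; rewrite hornerD hornerN !horner_lin; ring.
Qed.

(* Rows 4 and 5 correspond to the monomials x and x u, the others to u ^ i. *)
Definition scroll_minor (c : nat -> nat -> K) (i j : nat) : K :=
  \det (\matrix_(k < 4, l < 4) c (nth 0%N [:: i; j; 4; 5] k) l).

(* With m_ij the minors, the pencil of cubics cut out by the rows 4 and 5 has the Wronskian
   m01 + 2 m02 u + (3 m03 + m12) u^2 + 2 m13 u^3 + m23 u^4; the coefficients w_i of a quartic which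
   is a square satisfy w3^2 w0 = w1^2 w4. *)
Definition scroll_disc (c : nat -> nat -> K) : K :=
  scroll_minor c 1 3 ^+ 2 * scroll_minor c 0 1 - scroll_minor c 0 2 ^+ 2 * scroll_minor c 2 3.

Variable c : nat -> nat -> K.

Lemma scroll_minor_dep (w : nat -> K) k i j : (k < 4)%N -> w k != 0 ->
  (forall i, (i < 6)%N -> \sum_(l < 4) w l * c i l = 0) ->
  (i < 4)%N -> (j < 4)%N -> scroll_minor c i j = 0.
Proof.
move=> k4 wk wc i4 j4; apply/eqP; rewrite /scroll_minor -det_tr; apply/det0P.
exists (\row_l w l).
  by apply: contraNneq wk => /rowP/(_ (Ordinal k4)); rewrite !mxE => /eqP.
apply/rowP => -[l l4]; rewrite !mxE -[RHS](wc (nth 0%N [:: i; j; 4; 5] l)).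
  by apply: eq_bigr => m _; rewrite !mxE.
by case: l l4 => [|[|[|[|//]]]] _ /=; lia.
Qed.

Lemma scroll_disc_dep (w : nat -> K) k : (k < 4)%N -> w k != 0 ->
  (forall i, (i < 6)%N -> \sum_(l < 4) w l * c i l = 0) -> scroll_disc c = 0.
Proof.
move=> k4 wk wc; rewrite /scroll_disc !(scroll_minor_dep k4 wk wc) //.
by rewrite expr0n mul0r subrr.
Qed.

(** Column j of [c] is the form P_j(u) + x Q_j(u) on the scroll. *)
Let P j := cubic (c 0 j) (c 1 j) (c 2 j) (c 3 j).
Let Q j := lin (c 4 j) (c 5 j).

Lemma scroll_equations :
  (forall x u : K, x != 0 -> u != 0 ->
     ((P 0).[u] + x * (Q 0).[u]) * ((P 2).[u] + x * (Q 2).[u]) ^+ 3 =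
     ((P 1).[u] + x * (Q 1).[u]) ^+ 3 * ((P 3).[u] + x * (Q 3).[u])) ->
  [/\ P 0 * P 2 ^+ 3 = P 1 ^+ 3 * P 3,
      Q 0 * P 2 ^+ 3 + 3 * P 0 * P 2 ^+ 2 * Q 2 = 3 * P 1 ^+ 2 * Q 1 * P 3 + P 1 ^+ 3 * Q 3,
      3 * Q 0 * P 2 ^+ 2 * Q 2 + 3 * P 0 * P 2 * Q 2 ^+ 2 =
        3 * P 1 * Q 1 ^+ 2 * P 3 + 3 * P 1 ^+ 2 * Q 1 * Q 3,
      3 * Q 0 * P 2 * Q 2 ^+ 2 + P 0 * Q 2 ^+ 3 = Q 1 ^+ 3 * P 3 + 3 * P 1 * Q 1 ^+ 2 * Q 3 &
      Q 0 * Q 2 ^+ 3 = Q 1 ^+ 3 * Q 3].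
Proof.
move=> E.
pose l := [:: P 0 * P 2 ^+ 3;
  Q 0 * P 2 ^+ 3 + 3 * P 0 * P 2 ^+ 2 * Q 2;
  3 * Q 0 * P 2 ^+ 2 * Q 2 + 3 * P 0 * P 2 * Q 2 ^+ 2;
  3 * Q 0 * P 2 * Q 2 ^+ 2 + P 0 * Q 2 ^+ 3;
  Q 0 * Q 2 ^+ 3].
pose r := [:: P 1 ^+ 3 * P 3;
  3 * P 1 ^+ 2 * Q 1 * P 3 + P 1 ^+ 3 * Q 3;
  3 * P 1 * Q 1 ^+ 2 * P 3 + 3 * P 1 ^+ 2 * Q 1 * Q 3;
  Q 1 ^+ 3 * P 3 + 3 * P 1 * Q 1 ^+ 2 * Q 3;
  Q 1 ^+ 3 * Q 3].
suff lr k : l`_k = r`_k.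
  by split; [have := lr 0%N | have := lr 1%N | have := lr 2 | have := lr 3 | have := lr 4].
apply: polyP_neq0 => u u0.
have lrE : Poly [seq p.[u] | p <- l] = Poly [seq p.[u] | p <- r].
  have h3 : (3 : {poly K}).[u] = 3 by rewrite -polyC_natr hornerC.
  rewrite /l /r; move: (3 : {poly K}) h3 => t h3.
  apply: polyP_neq0 => x x0; rewrite !horner_Poly /=.
  have := E x u x0 u0; rewrite !(hornerD, hornerM, horner_exp) h3.
  move=> {}E; apply: etrans (etrans E _); ring.
have : (Poly [seq p.[u] | p <- l])`_k = (Poly [seq p.[u] | p <- r])`_k by rewrite lrE.
rewrite !coef_Poly /l /r.
by do 5?[case: k => [//|k]]; rewrite /= !nth_nil.
Qed.

Lemma scroll_disc_eq0 :
  (forall x u : K, x != 0 -> u != 0 ->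
     ((P 0).[u] + x * (Q 0).[u]) * ((P 2).[u] + x * (Q 2).[u]) ^+ 3 =
     ((P 1).[u] + x * (Q 1).[u]) ^+ 3 * ((P 3).[u] + x * (Q 3).[u])) ->
  scroll_disc c = 0.
Proof.
case/scroll_equations => E0 E1 E2 E3 E4.
have column0 j : (j < 4)%N -> P j = 0 -> Q j = 0 -> scroll_disc c = 0.
  move=> j4 Pj Qj; apply: (@scroll_disc_dep (fun l => (l == j)%:R) j) => //.
    by rewrite eqxx oner_neq0.
  have P0 : cubic 0 0 0 0 = 0 :> {poly K}.
    by apply: polyP_neq0 => x _; rewrite horner_cubic horner0; ring.
  have Q0 : lin 0 0 = 0 :> {poly K} by apply/eqP; rewrite lin_eq0 eqxx.
  have [c0 c1 c2 c3] := cubic_inj (etrans Pj (esym P0)).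
  have [c4 c5] := lin_inj (etrans Qj (esym Q0)).
  move=> i i6; rewrite (bigD1 (Ordinal j4)) //= eqxx mul1r big1 ?addr0.
    by case: i i6 => [|[|[|[|[|[|//]]]]]].
  by move=> l /negPf lj; rewrite (_ : (l == j :> nat) = false) ?mul0r // -lj.
have [/andP[/eqP P3 /eqP Q3]|] := boolP ((P 3 == 0) && (Q 3 == 0)); first exact: (@column0 3).
rewrite negb_and => f3; have cross := linear_chain_cross E0 E1 E2 E3 E4 f3.
have [Q20|Q20] := eqVneq (Q 2) 0; have [Q10|Q10] := eqVneq (Q 1) 0.
(* Here the x-linear coefficient reads Q0 P2^3 = P1^3 Q3, so Q0 and Q3 are proportional, and every
   minor contains their vanishing 2 x 2 determinant. *)
- have [P1|P1] := eqVneq (P 1) 0; first exact: (@column0 1%N).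
  have [P2|P2] := eqVneq (P 2) 0; first exact: (@column0 2%N).
  rewrite Q10 Q20 !(mulr0, addr0, mul0r, add0r) in E1.
  have D := lin_cube_ratio P1 P2 E1.
  move/eqP: Q10; move/eqP: Q20; rewrite !lin_eq0 => /andP[/eqP c42 /eqP c52] /andP[/eqP c41 /eqP c51].
  have m0 i j : (i < 4)%N -> (j < 4)%N -> scroll_minor c i j = 0.
    move=> i4 j4; rewrite /scroll_minor (det_mx44 (fun k => c (nth 0%N [:: i; j; 4; 5] k))) /= c41 c42 c51 c52.
    transitivity ((c i 1%N * c j 2%N - c i 2%N * c j 1%N) *
      (c 4%N 0%N * c 5%N 3%N - c 4%N 3%N * c 5%N 0%N)); first by ring.
    by rewrite D subrr mulr0.
  by rewrite /scroll_disc !m0 // expr0n mul0r subrr.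
- apply: (@column0 2%N) => //; apply: (mulIf Q10).
  by rewrite -cross Q20 mulr0 mul0r.
- apply: (@column0 1%N) => //; apply: (mulIf Q20).
  by rewrite cross Q10 mulr0 mul0r.
(* If Q1 and Q2 are proportional, the cross relation makes P1 and P2 proportional with the same
   ratio, hence two columns dependent. *)
have [D|D] := eqVneq (c 4%N 1%N * c 5%N 2%N) (c 4%N 2%N * c 5%N 1%N).
  have dep (x y : K) : x != 0 -> x *: Q 1 = y *: Q 2 -> scroll_disc c = 0.
    move=> x0 Q12; apply: (@scroll_disc_dep (fun l => [:: 0; x; - y; 0]`_l) 1) => //.
    have P12 : x *: P 1 = y *: P 2.
      apply: (mulIf Q20); rewrite -scalerAl cross scalerAr Q12.
      by rewrite -scalerAr scalerAl.
    have [c0 c1 c2 c3] : [/\ x * c 0 1 = y * c 0 2, x * c 1 1 = y * c 1 2,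
        x * c 2 1 = y * c 2 2 & x * c 3 1 = y * c 3 2].
      by apply: cubic_inj; rewrite -!scale_cubic.
    have [c4 c5] : x * c 4 1 = y * c 4 2 /\ x * c 5 1 = y * c 5 2.
      by apply: lin_inj; rewrite -!scale_lin.
    move=> i i6; rewrite !big_ord_recl big_ord0 /= mul0r mul0r add0r !addr0 mulNr.
    by case: i i6 => [|[|[|[|[|[|//]]]]]] _; rewrite ?c0 ?c1 ?c2 ?c3 ?c4 ?c5 subrr.
  have [c42|c42] := eqVneq (c 4%N 2%N) 0.
    have c52 : c 5%N 2%N != 0.
      by apply: contra Q20 => /eqP c52; rewrite lin_eq0 c42 c52 eqxx.
    apply: (dep (c 5 2)%N (c 5 1)%N) => //; rewrite !scale_lin.
    by congr lin; [rewrite mulrC D mulrC | rewrite mulrC].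
  apply: (dep (c 4 2)%N (c 4 1)%N) => //; rewrite !scale_lin.
  by congr lin; [rewrite mulrC | rewrite D].
have co : coprimep (Q 1) (Q 2) by exact: coprimep_lin.
have sQ : (size (Q 1) == 2)%N || (size (Q 2) == 2)%N.
  have [c51|c51] := eqVneq (c 5%N 1%N) 0; last by rewrite size_lin_nonconst.
  have [c52|c52] := eqVneq (c 5%N 2%N) 0; last by rewrite orbC size_lin_nonconst.
  by rewrite c51 c52 !mulr0 eqxx in D.
have s4 (a b : K) : (size (lin a b) <= 4)%N by rewrite (leq_trans (size_lin a b)).
have [r [Q0r Q3r]] := coprime_cube_ratio co Q10 Q20 (s4 _ _) (s4 _ _) sQ E4.
have Q03 : Q 0 = 0 /\ Q 3 = 0.
  (* Otherwise Q0 or Q3 would be a nonzero multiple of the cube of a degree 1 polynomial, hence of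
     degree 3. *)
  suff r0 : r = 0 by rewrite -[Q 0]/(lin _ _) Q0r -[Q 3]/(lin _ _) Q3r r0 !scale0r.
  apply/eqP/negPn/negP => r0.
  have cube (q p : {poly K}) : q != 0 -> size q == 2%N -> p = r *: q ^+ 3 -> (size p <= 2)%N -> False.
    move=> q0 /eqP q2 ->; rewrite size_scale //.
    by rewrite -[size _]prednK ?size_exp ?q2 // size_poly_gt0 expf_neq0.
  case/orP: sQ => sQ; [exact: (cube _ _ Q10 sQ Q0r (size_lin _ _)) |
    exact: (cube _ _ Q20 sQ Q3r (size_lin _ _))].
have [Q0 Q3] := Q03.
have E3' : P 0 * Q 2 ^+ 3 = Q 1 ^+ 3 * P 3.
  by move: E3; rewrite Q0 Q3 !(mulr0, mul0r, addr0, add0r).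
(* The pencil cut out by q = 0 is spanned by P0 and P3, which are multiples of cubes of Q1 and
   Q2. *)
have [t [P0t P3t]] := coprime_cube_ratio co Q10 Q20 (size_cubic _ _ _ _) (size_cubic _ _ _ _) sQ E3'.
rewrite scale_lin_cube in P0t; have [c00 c10 c20 c30] := cubic_inj P0t.
rewrite scale_lin_cube in P3t; have [c03 c13 c23 c33] := cubic_inj P3t.
move/eqP: Q0; rewrite lin_eq0 => /andP[/eqP c40 /eqP c50].
move/eqP: Q3; rewrite lin_eq0 => /andP[/eqP c43 /eqP c53].
have mE i j : scroll_minor c i j = (c i 0 * c j 3 - c i 3 * c j 0) *
    (c 4 1 * c 5 2 - c 4 2 * c 5 1).
  rewrite /scroll_minor (det_mx44 (fun k => c (nth 0%N [:: i; j; 4; 5] k))) /=.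
  by rewrite c40 c50 c43 c53; ring.
by rewrite /scroll_disc !mE c00 c10 c20 c30 c03 c13 c23 c33; ring.
Qed.

End Scroll.

(** * Projections of the cubic scroll polygon *)

Section ScrollProjection.
Variables (R : realType) (K : numFieldType) (N : nat) (b : 'M[int]_(2, N.+1)).
Hypothesis hb : enum_lattice_points R 3 b.

(** The six lattice points for d = 3 lie on two parallel edges of a trapezoid. In the coordinates x
    and u = xy their monomials are u^i for i <= 3, then x and xu. *)
Definition scroll_point (i : nat) : nat * nat :=
  match i with 4 => (1, 0) | 5 => (2, 1) | _ => (i, i) end%N.

Lemma scroll_index : exists2 s : 'I_6 -> 'I_N.+1, bijective s &
  forall i, b 0 (s i) = (scroll_point i).1%:Z /\ b 1 (s i) = (scroll_point i).2%:Z.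
Proof.
have [b_inj bE] := hb.
have [s sE] : exists s : 'I_6 -> 'I_N.+1, forall j,
    b 0 (s j) = (scroll_point j).1%:Z /\ b 1 (s j) = (scroll_point j).2%:Z.
  apply: (@fin_all_exists _ _ (fun (j : 'I_6) (k : 'I_N.+1) =>
    b 0 k = (scroll_point j).1%:Z /\ b 1 k = (scroll_point j).2%:Z)) => j.
  pose x : 'cV[int]_2 := \col_i (if i == 0 then (scroll_point j).1 else (scroll_point j).2)%:Z.
  have : binom_lattice_points R 3 x.
    case jE: (nat_of_ord j) (ltn_ord j) => [|[|[|[|[|[|//]]]]]] _;
      [have := @lattice_point_segment R 3 x 0 1 1 | have := @lattice_point_segment R 3 x 3 1 3
      |have := @lattice_point_segment R 3 x 3 2 3 | have := @lattice_point_segment R 3 x 3 1 1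
      |have := @lattice_point_segment R 3 x 1 1 1 | have := @lattice_point_segment R 3 x 2 1 1];
      by rewrite !mxE jE; apply.
  rewrite -bE => -[k _ kE]; exists k.
  by have := congr1 (fun A : 'cV_2 => A 0 0) kE; have := congr1 (fun A : 'cV_2 => A 1 0) kE;
    rewrite !mxE.
exists s => //; have s_inj : injective s.
  move=> i j sij; apply: ord_inj.
  have [] := sE j; rewrite -sij; have [-> ->] := sE i; rewrite /scroll_point.
  case: (nat_of_ord i) (ltn_ord i) => [|[|[|[|[|[|//]]]]]] _;
    case: (nat_of_ord j) (ltn_ord j) => [|[|[|[|[|[|//]]]]]] _ //=.
have s_surj k : exists i, s i = k.
  have : binom_lattice_points R 3 (col k b) by rewrite -bE; exists k.
  move=> hk; have ineq u v w := lattice_point_ineq (u := u) (v := v) (w := w) hk.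
  rewrite !mxE in ineq.
  (* The four edges of the trapezoid, followed by the bound 3 on the first coordinate. *)
  have := ineq 0 1 (-1) ltac:(by case=> [|[|[|[|//]]]]).
  have := ineq 0 0 1 ltac:(by case=> [|[|[|[|//]]]]).
  have := ineq 1 (-1) 1 ltac:(by case=> [|[|[|[|//]]]]).
  have := ineq 3 (-2) 1 ltac:(by case=> [|[|[|[|//]]]]).
  have := ineq 3 (-1) 0 ltac:(by case=> [|[|[|[|//]]]]).
  move=> h1 h2 h3 h4 h5.
  suff [i [i6 [i0 i1]]] : exists i, (i < 6)%N /\
      b 0 k = (scroll_point i).1%:Z /\ b 1 k = (scroll_point i).2%:Z.
    exists (Ordinal i6); apply: b_inj; apply/colP => l; rewrite !mxE.
    have [s0 s1] := sE (Ordinal i6).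
    have [->|->] : l = 0 \/ l = 1.
      by case: l => [[|[|//]] ?]; [left|right]; exact/val_inj.
    - by rewrite s0 i0.
    - by rewrite s1 i1.
  have [xy|xy] := eqVneq (b 0 k) (b 1 k).
    exists `|b 1%R k|%N; rewrite /scroll_point; move: xy h1 h2 h3 h4 h5 => ->.
    case: (b 1 k) => // -[|[|[|[|n]]]] //=; lia.
  have [b1|b1] := eqVneq (b 1 k) 0; [exists 4%N | exists 5%N]; rewrite /=; lia.
have [f fK] := fin_all_exists s_surj.
by exists f => // i; apply: s_inj.
Qed.

Definition scroll_coef (s : 'I_6 -> 'I_N.+1) (L : 'M[K]_(N.+1, 4)) (i j : nat) : K :=
  L (s (inord i)) (inord j).

Lemma polyfun_scroll_disc s : polyfun (fun L => scroll_disc (scroll_coef s L)).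
Proof.
have minor i j : polyfun (fun L => scroll_minor (scroll_coef s L) i j).
  by apply: polyfun_det => k l; under [fun _ => _]boolp.funext do rewrite mxE; exact: polyfun_entry.
by apply: polyfunB; apply: polyfunM => //; exact: polyfunX.
Qed.

(** A change of coordinates [M] multiplies each minor by its determinant and the cubic discriminant
    by the cube of it, so it suffices to treat [L *m M]. *)
Lemma scroll_disc_projection_eq0 (s : 'I_6 -> 'I_N.+1) (L : 'M[K]_(N.+1, 4)) (M : 'M[K]_4) :
  bijective s ->
  (forall i, b 0 (s i) = (scroll_point i).1%:Z /\ b 1 (s i) = (scroll_point i).2%:Z) ->
  M \in unitmx ->
  (forall t, @torus K 2 t ->
     cubic_chain (fun j => (toric_map (add_ones b) t *m L *m M) 0 j)) ->
  scroll_disc (scroll_coef s L) = 0.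
Proof.
move=> s_bij sE Mu chain.
have minorM i j : scroll_minor (scroll_coef s (L *m M)) i j =
    scroll_minor (scroll_coef s L) i j * \det M.
  rewrite /scroll_minor -det_mulmx; congr (\det _); apply/matrixP => k l.
  by rewrite !mxE /scroll_coef mxE inord_val; apply: eq_bigr => m _; rewrite !mxE inord_val.
have discM : scroll_disc (scroll_coef s (L *m M)) = scroll_disc (scroll_coef s L) * \det M ^+ 3.
  by rewrite /scroll_disc !minorM; ring.
have detM : \det M ^+ 3 != 0 by rewrite expf_neq0 // -unitfE -unitmxE.
apply: (mulIf detM); rewrite mul0r -discM; set c := scroll_coef s (L *m M).
apply: scroll_disc_eq0 => x u x0 u0.
(* The product of the two torus coordinates is u. *)
pose t : 'rV[K]_2 := \row_i (if i == 0 then x else u / x).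
have tT : @torus K 2 t by move=> i; rewrite mxE; case: ifP; rewrite ?mulf_neq0 ?invr_eq0.
have fE j : (toric_map (add_ones b) t *m L *m M) 0 (inord j) =
    (cubic (c 0 j) (c 1 j) (c 2 j) (c 3 j)).[u] + x * (lin (c 4 j) (c 5 j)).[u].
  rewrite -mulmxA mxE (reindex s) /=; last exact: onW_bij.
  have mE i : toric_map (add_ones b) t 0 (s i) =
      x ^+ (scroll_point i).1 * (u / x) ^+ (scroll_point i).2.
    rewrite mxE /add_ones col_mxKd !big_ord_recl big_ord0 mulr1.
    rewrite (_ : lift ord0 ord0 = 1); last exact/val_inj.
    by have [-> ->] := sE i; rewrite !mxE.
  have cE (i : 'I_6) : (L *m M) (s i) (inord j) = c i j by rewrite /c /scroll_coef inord_val.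
  under eq_bigr do rewrite mE cE.
  rewrite !big_ord_recl big_ord0 horner_cubic horner_lin /scroll_point /bump /=.
  by field.
by have := chain t tT 0 isT; rewrite !fE.
Qed.

(* The pencil of cubics spanned by u and 1 + u ^ 3. *)
Lemma exists_scroll_disc_neq0 (s : 'I_6 -> 'I_N.+1) : bijective s ->
  exists2 L, row_full L & scroll_disc (scroll_coef s L) != 0.
Proof.
case=> s' sK s'K.
(* The projection (x, xu, u, 1 + u^3). *)
pose T i j := ((i, j) \in [:: (4, 0); (5, 1); (1, 2); (0, 3); (3, 3)])%N.
pose L : 'M[K]_(N.+1, 4) := \matrix_(k, j) (T (s' k) j)%:R.
have LE i j : (i < 6)%N -> (j < 4)%N -> scroll_coef s L i j = (T i j)%:R.
  by move=> i6 j4; rewrite /scroll_coef mxE sK !inordK.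
exists L.
  apply/row_fullP; pose r (j : 'I_4) := s (inord (nth 0%N [:: 4; 5; 1; 0] j)).
  exists (selection_mx K r)^T; apply: (can_inj trmxK).
  rewrite trmx_mul trmxK mulmx_selection; apply/matrixP => i j; rewrite !mxE sK.
  rewrite inordK; first by case: i => [[|[|[|[|//]]]] ?]; case: j => [[|[|[|[|//]]]] ?].
  by case: j => [[|[|[|[|//]]]] ?].
have mE i j : (i < 4)%N -> (j < 4)%N -> scroll_minor (scroll_coef s L) i j =
    \det (\matrix_(k < 4, l < 4) (T (nth 0%N [:: i; j; 4; 5] k) l)%:R).
  move=> i4 j4; congr (\det _); apply/matrixP => k l; rewrite !mxE LE //.
  by case: k => [[|[|[|[|//]]]] ?] /=; lia.
rewrite /scroll_disc !mE // !(det_mx44 (fun k l => (T (nth 0%N _ k) l)%:R)) /T /=.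
by rewrite (_ : _ - _ = -1) ?oppr_eq0 ?oner_eq0 //; ring.
Qed.

End ScrollProjection.

(** * The open set of projections for every d >= 3 *)

Lemma enum_lattice_bounds (R : realType) d N (b : 'M[int]_(2, N.+1)) :
  enum_lattice_points R d b ->
  forall k, [/\ 0 <= b 0 k, 0 <= b 1 k & b 0 k <= d%:Z].
Proof.
case=> _ bE k; have hk : binom_lattice_points R d (col k b) by rewrite -bE; exists k.
have ineq u v w := lattice_point_ineq (u := u) (v := v) (w := w) hk.
rewrite !mxE in ineq; split.
- by have := ineq 0 1 0; rewrite !(add0r, mul1r, mul0r, addr0); apply=> j _; lia.
- by have := ineq 0 0 1; rewrite !(add0r, mul1r, mul0r); apply=> j _; lia.
- by have := ineq d%:Z (-1) 0; rewrite mul0r addr0 mulN1r subr_ge0; apply=> j jd; lia.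
Qed.

Theorem corollary4p4 (R : realType) (d : nat) (hd : (3 <= d)%N)
    (N : nat) (b : 'M[int]_(2, N.+1)) (hb : enum_lattice_points R d b) :
  exists U : set 'M[R[i]]_(N.+1, d.+1),
    [/\ open_in_surjections U,
        U !=set0 &
        forall L, U L ->
          ~ proj_equiv
              (proj_closure (proj_image L (toric_variety (add_ones b))))
              (toric_variety (binom_matrix d))].
Proof.
(* The jet discriminant needs five target coordinates, so d = 3 is treated through the scroll. *)
have [d3|d3] := eqVneq d 3; first subst d.
  have [s s_bij sE] := scroll_index hb.
  exists [set L | row_full L /\ scroll_disc (scroll_coef s L) != 0]; split.
  - exact/open_nonzero/polyfun_scroll_disc.
  - by have [L Lf L0] := exists_scroll_disc_neq0 R[i] s_bij; exists L.
  - move=> L [_ /eqP L0] /proj_equiv_cubic_chain[M Mu chain]; apply: L0.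
    exact: scroll_disc_projection_eq0 s_bij sE Mu chain.
have d4 : (4 <= d)%N by rewrite ltn_neqAle eq_sym d3.
have [g [L0 L0f disc0]] := exists_jet_disc_neq0 R[i] d4 hb.
exists [set L | row_full L /\ jet_disc b g L != 0]; split.
- exact/open_nonzero/polyfun_jet_disc.
- by exists L0.
- move=> L [Lf /eqP disc] /proj_equiv_cubic_chain[M Mu chain]; apply: disc.
  have bounds := enum_lattice_bounds hb.
  apply: jet_disc_eq0 Lf Mu chain; last by case: hb.
    by move=> k; case: (bounds k).
  by move=> k; case: (bounds k).
Qed.
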